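(* Let $n,m,k$ be positive integers with $k>1$. Then there exists an infinite family of $k$-component virtual links $L$ with unknotting index $U(L)=(n,0)$, and there exists an infinite family of $k$-component virtual links $L$ with unknotting index $U(L)=(0,m)$.
   Context: A $k$-component virtual link diagram is a generic immersion of $k$ circles in the plane whose double points are each marked either as a classical crossing (with over/under information) or as a virtual crossing (no over/under information). Two diagrams are equivalent if they are related by a finite sequence of classical Reidemeister moves RI, RII, RIII, virtual Reidemeister moves VRI, VRII, VRIII (the analogues of RI, RII, RIII in which all crossings are virtual), and the semi-virtual move SV (moving an arc having only virtual crossings across a classical crossing), together with planar isotopy. A $k$-component virtual link $L$ is an equivalence class of $k$-component virtual link diagrams; $[L]$ denotes the set of its diagrams. The $k$-component trivial link is the class of the crossingless diagram of $k$ disjoint, unnested circles. Virtualizing a classical crossing means replacing it by a virtual crossing; a crossing change means exchanging the over and under strands at a classical crossing. For non-negative integers $n,m$, a virtual link diagram $D$ is $(n,m)$-unknottable if, by virtualizing $n$ classical crossings of $D$ and applying crossing changes at $m$ classical crossings of $D$, one obtains a diagram of the trivial link. The unknotting index $U(D)$ of the diagram $D$ is the minimum, in the dictionary (lexicographic) order, of all pairs $(n,m)$ such that $D$ is $(n,m)$-unknottable. The unknotting index of a virtual link $L$ is $U(L)=\min\{U(D) : D\in [L]\}$, the minimum again being taken in the dictionary order. *)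

(* Defs.v *)
From mathcomp Require Import all_boot all_order.
From mathcomp Require Import classical_sets.
From Stdlib Require Import Relation_Operators.

Set Implicit Arguments.
Unset Strict Implicit.
Unset Printing Implicit Defensive.

Local Open Scope nat_scope.
Local Open Scope classical_set_scope.

(** Plane diagrams are recorded in Morse position with respect to the height:
    a diagram is the list, from bottom to top, of its local minima, local maxima
    and double points, each with the number of strands to its left.  Generic
    immersed closed curves in the plane, up to planar isotopy, are exactly these
    lists up to the first five relations of [local_move] below. *)

(** [Classical true]: the strand running from lower left to upper right is the
    over strand; [Classical false]: the one from lower right to upper left. *)
Inductive marking := Classical of bool | Virtual.

Definition flip (c : marking) : marking :=
  if c is Classical b then Classical (~~ b) else Virtual.

(** [Cup] is a local minimum (two strands are born), [Cap] a local maximum. *)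
Inductive piece := Cup | Cap | Cross of marking.

Definition nin (a : piece) : nat := if a is Cup then 0 else 2.
Definition nout (a : piece) : nat := if a is Cap then 0 else 2.

(** [(a, i)] occupies the strands i, i+1 (numbered from 0, left to right). *)
Definition word := seq (piece * nat).

(** Starting with [N] strands, every piece fits and no strand is left on top. *)
Fixpoint closes (N : nat) (w : word) : bool :=
  if w is (a, i) :: w' then
    (i + nin a <= N) && closes (N - nin a + nout a) w'
  else N == 0.

Definition is_closed (w : word) : bool := closes 0 w.

(** Number of immersed circles.  [s] labels the strands at the current height,
    two strands having the same label iff they are joined below that height; a
    maximum either closes up a circle or merges two labels.  Crossings (of any
    kind) are traversed straight ahead.  [fresh] is an unused label. *)
Fixpoint circles (fresh : nat) (s : seq nat) (w : word) : nat :=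
  match w with
  | [::] => 0
  | (Cup, i) :: w' =>
      circles fresh.+1 (take i s ++ [:: fresh; fresh] ++ drop i s) w'
  | (Cross _, i) :: w' =>
      circles fresh (take i s ++ [:: nth 0 s i.+1; nth 0 s i] ++ drop i.+2 s) w'
  | (Cap, i) :: w' =>
      let x := nth 0 s i in
      let y := nth 0 s i.+1 in
      (x == y) + circles fresh
        [seq if z == y then x else z | z <- take i s ++ drop i.+2 s] w'
  end.

Definition component_count (w : word) : nat := circles 0 [::] w.

Definition diagram (k : nat) :=
  {w : word | is_closed w && (component_count w == k)}.

Definition classical_crossing (b : bool) (i : nat) : piece * nat :=
  (Cross (Classical b), i).
Definition virtual_crossing (i : nat) : piece * nat := (Cross Virtual, i).

Inductive local_move : word -> word -> Prop :=
(* planar isotopy: exchange of heights of two distant pieces, [d] strands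
   apart; creation or cancellation of two consecutive extrema; passage of an
   extremum through a crossing *)
| iso_height a b i d :
    local_move [:: (a, i); (b, i + nout a + d)] [:: (b, i + nin a + d); (a, i)]
| iso_zigzag_left i : local_move [:: (Cup, i); (Cap, i.+1)] [::]
| iso_zigzag_right i : local_move [:: (Cup, i.+1); (Cap, i)] [::]
| iso_swing_cap c i :
    local_move [:: (Cross c, i); (Cap, i.+1)] [:: (Cross (flip c), i.+1); (Cap, i)]
| iso_swing_cup c i :
    local_move [:: (Cup, i); (Cross c, i.+1)] [:: (Cup, i.+1); (Cross (flip c), i)]
| RI_cap b i : local_move [:: classical_crossing b i; (Cap, i)] [:: (Cap, i)]
| RI_cup b i : local_move [:: (Cup, i); classical_crossing b i] [:: (Cup, i)]
| RII b i :
    local_move [:: classical_crossing b i; classical_crossing (~~ b) i] [::]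
(* [a], [b], [c] mark the crossings of strands 1,2 / 1,3 / 2,3; the hypothesis
   says that "being over" is not cyclic on the three strands *)
| RIII a b c i : (a = c -> b = a) ->
    local_move
      [:: classical_crossing a i; classical_crossing b i.+1; classical_crossing c i]
      [:: classical_crossing c i.+1; classical_crossing b i; classical_crossing a i.+1]
| VRI_cap i : local_move [:: virtual_crossing i; (Cap, i)] [:: (Cap, i)]
| VRI_cup i : local_move [:: (Cup, i); virtual_crossing i] [:: (Cup, i)]
| VRII i : local_move [:: virtual_crossing i; virtual_crossing i] [::]
| VRIII i :
    local_move
      [:: virtual_crossing i; virtual_crossing i.+1; virtual_crossing i]
      [:: virtual_crossing i.+1; virtual_crossing i; virtual_crossing i.+1]
(* the strand with only virtual crossings is the third, second, first one *)
| SV_3 b i :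
    local_move
      [:: classical_crossing b i; virtual_crossing i.+1; virtual_crossing i]
      [:: virtual_crossing i.+1; virtual_crossing i; classical_crossing b i.+1]
| SV_2 b i :
    local_move
      [:: virtual_crossing i; classical_crossing b i.+1; virtual_crossing i]
      [:: virtual_crossing i.+1; classical_crossing b i; virtual_crossing i.+1]
| SV_1 b i :
    local_move
      [:: virtual_crossing i; virtual_crossing i.+1; classical_crossing b i]
      [:: classical_crossing b i.+1; virtual_crossing i; virtual_crossing i.+1].

Inductive move : word -> word -> Prop :=
| Move u v l r : local_move l r ->
    is_closed (u ++ l ++ v) -> is_closed (u ++ r ++ v) ->
    move (u ++ l ++ v) (u ++ r ++ v).

Definition equivalent : word -> word -> Prop := clos_refl_sym_trans word move.

(** A link is identified with the set [[L]] of its diagrams. *)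
Definition is_virtual_link (k : nat) (L : set (diagram k)) : Prop :=
  exists D : diagram k, L = [set D' | equivalent (val D) (val D')].

Definition trivial_diagram (k : nat) : word :=
  flatten (nseq k [:: (Cup, 0); (Cap, 0)]).

(** [alter n m w w']: [w'] is [w] with [n] classical crossings virtualized and
    crossing changes at [m] other classical crossings. *)
Inductive alter : nat -> nat -> word -> word -> Prop :=
| alter_nil : alter 0 0 [::] [::]
| alter_keep n m w w' x : alter n m w w' -> alter n m (x :: w) (x :: w')
| alter_virtualize n m w w' b i : alter n m w w' ->
    alter n.+1 m (classical_crossing b i :: w) (virtual_crossing i :: w')
| alter_change n m w w' b i : alter n m w w' ->
    alter n m.+1 (classical_crossing b i :: w) (classical_crossing (~~ b) i :: w').

Definition unknottable (k : nat) (D : diagram k) (n m : nat) : Prop :=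
  exists2 w, alter n m (val D) w & equivalent w (trivial_diagram k).

(** [*l] is the product with the lexicographic order. *)
Definition is_lex_min (S : set (nat *l nat)) (p : nat *l nat) : Prop :=
  S p /\ forall q, S q -> (p <= q)%O.

Definition diagram_index (k : nat) (D : diagram k) (p : nat *l nat) : Prop :=
  is_lex_min [set q | unknottable D q.1 q.2] p.

Definition unknotting_index (k : nat) (L : set (diagram k)) (p : nat *l nat) :
    Prop :=
  is_lex_min [set q | exists2 D, L D & diagram_index D q] p.

(* Main.v *)
Require Import Defs.
From mathcomp Require Import all_boot all_order.
From mathcomp Require Import all_algebra.
From mathcomp Require Import boolp classical_sets.
From mathcomp Require Import zify ring.
From Stdlib Require Import Relation_Operators.

Set Implicit Arguments.
Unset Strict Implicit.
Unset Printing Implicit Defensive.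

(** Every component is oriented and put into one of two classes, "levelled" or
    "plain".  The strands of a levelled component carry an integer level, which
    jumps by one at each classical crossing with a levelled strand, according to
    the direction in which the other strand passes.  For a fixed odd function
    [f], two numbers are transported by all moves: the span (the signed number of
    crossings at which a levelled strand passes over a plain one, minus the signed
    number of those at which it passes under), and the sum over the crossings of
    levelled strands of sign times [f] of the index, i.e. of the difference of the
    levels of the two strands.  Both vanish on the trivial link.

    Changing crossings affects neither, and virtualizing [n] crossings between the
    two classes changes the span by at most [n]; virtualizing a crossing between
    levelled strands destroys the levels.  So a link with span [n - 1] and nonzero
    index sum cannot be undone by [n - 1] virtualizations.  For an arbitrary [f]
    with [|f t + f (-t)| <= 1], a crossing change alters the index sum by at most
    one, which bounds the number of crossing changes from below.

    With [s] a classical and [v] a virtual crossing of two strands, the closure of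
    [(s v)^p s^(2m) (v s^-1)^p v] has [m] pairs of crossings of index [2p + 1] and
    [-(2p + 1)] while all other contributions cancel, and [m] crossing changes
    reduce it to the closure of [v].  The closure of the braid
    [(s1 v1)^p s2 v2 (v1 s1^-1)^p v1 v2] has a crossing of index [2p] that no other
    crossing compensates, and virtualizing [s2] reduces it to the closure of
    [v1 v2]; a circle twisted [n - 1] times around its first strand supplies the
    span.  In both families the index distinguishes the links. *)

Import Order.TTheory GRing.Theory Num.Theory.
Local Open Scope ring_scope.

(* [(o, h)]: the strand is oriented upwards iff [o]; [h] is its level, or [None]
   on a plain component. *)
Definition color := (bool * option int)%type.
Definition bar (x : color) : color := (~~ x.1, x.2).

Lemma barK : involutive bar.
Proof. by case=> o h; rewrite /bar /= negbK. Qed.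

Definition sgn (o o' : bool) : int := if o == o' then 1 else -1.

Lemma sgnNl o o' : sgn (~~ o) o' = - sgn o o'.
Proof. by case: o o' => [] []. Qed.

Lemma sgnNr o o' : sgn o (~~ o') = - sgn o o'.
Proof. by case: o o' => [] []. Qed.

Lemma sgnC o o' : sgn o o' = sgn o' o.
Proof. by case: o o' => [] []. Qed.

(** * Colorings of the strands and their two weights *)

Section Coloring.

(* [g] is the height of the jumps of the levels: 1, or 0 to forget the levels. *)
Variables (g : int) (f : int -> int).

Definition ori (o : bool) : int := if o then g else - g.

Lemma oriN o : ori (~~ o) = - ori o.
Proof. by case: o; rewrite /ori //= opprK. Qed.

Definition pass (c : marking) (x y : color) (t : int) : color :=
  (x.1, match c, x.2, y.2 with
        | Classical _, Some a, Some _ => Some (a + t)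
        | _, o, _ => o
        end).

(* Twice the level with which one leaves the lower-left strand at its pass minus
   the level with which one enters the other; this is twice the index if the
   lower-left strand is over, and minus twice the index if it is under.  Doubling
   makes the formula the same for all orientations. *)
Definition gap (x y : color) : int :=
  (odflt 0 x.2 - odflt 0 y.2) * 2 + ori x.1 + ori y.1.

(** The marking drops out: exchanging over and under reverses both the sign of the crossing and the
    role of the levelled strand. Hence crossing changes keep the span. *)
Definition span_weight (c : marking) (x y : color) : int :=
  match c, x.2, y.2 with
  | Classical _, Some _, None => sgn x.1 y.1
  | Classical _, None, Some _ => - sgn x.1 y.1
  | _, _, _ => 0
  end.

(** The sign of the crossing is [sgn], negated when [b] is false, and [f] receives twice the
    index. *)
Definition self_weight (c : marking) (x y : color) : int :=
  match c, x.2, y.2 with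
  | Classical b, Some _, Some _ =>
      sgn x.1 y.1 * (if b then f (gap x y) else - f (- gap x y))
  | _, _, _ => 0
  end.

Definition act (a : piece) (xs ys : seq color) (u1 u2 : int) : Prop :=
  match a with
  | Cup => xs = [::] /\ exists x, [/\ ys = [:: x; bar x], u1 = 0 & u2 = 0]
  | Cap => ys = [::] /\ exists x, [/\ xs = [:: x; bar x], u1 = 0 & u2 = 0]
  | Cross c => exists x y,
      [/\ xs = [:: x; y],
          ys = [:: pass c y x (- ori x.1); pass c x y (ori y.1)],
          u1 = span_weight c x y & u2 = self_weight c x y]
  end.

(* Some coloring of [w] with [s] on the bottom strands has span [z1] and index
   sum [z2]. *)
Fixpoint wt (w : word) (s : seq color) (z1 z2 : int) : Prop :=
  if w is (a, i) :: w' then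
    exists ys u1 u2, act a (take (nin a) (drop i s)) ys u1 u2 /\
      wt w' (take i s ++ ys ++ drop (i + nin a) s) (z1 - u1) (z2 - u2)
  else [/\ s = [::], z1 = 0 & z2 = 0].

Lemma act_size a xs ys u1 u2 : act a xs ys u1 u2 -> size ys = nout a.
Proof. by case: a => [[_ [x [-> _ _]]]|[-> _]|c [x [y [_ -> _ _]]]]. Qed.

(** An equality of propositions, like those that follow, so that a word is evaluated by rewriting
    from bottom to top. *)
Lemma wt_cons a i p xs r w z1 z2 : size p = i -> size xs = nin a ->
  wt ((a, i) :: w) (p ++ xs ++ r) z1 z2 =
  exists ys u1 u2, act a xs ys u1 u2 /\
      wt w (p ++ ys ++ r) (z1 - u1) (z2 - u2).
Proof.
move=> <- sx /=; rewrite drop_size_cat // take_size_cat //.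
by rewrite -sx take_size_cat // addnC -drop_drop drop_size_cat // drop_size_cat.
Qed.

Arguments wt : simpl never.

Lemma wt_cross i p (sp : size p = i) c x y r w z1 z2 :
  wt ((Cross c, i) :: w) (p ++ x :: y :: r) z1 z2 =
  wt w (p ++ pass c y x (- ori x.1) :: pass c x y (ori y.1) :: r)
    (z1 - span_weight c x y) (z2 - self_weight c x y).
Proof.
rewrite (@wt_cons (Cross c) i p [:: x; y] r) //.
apply/propext; split=> [[ys [u1 [u2 [[x' [y' [[-> ->] -> -> ->]]]]]] //]|h].
exists [:: pass c y x (- ori x.1); pass c x y (ori y.1)].
by exists (span_weight c x y), (self_weight c x y); split=> //; exists x, y.
Qed.

Lemma wt_cup i p (sp : size p = i) r w z1 z2 :
  wt ((Cup, i) :: w) (p ++ r) z1 z2 =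
  exists x, wt w (p ++ x :: bar x :: r) z1 z2.
Proof.
rewrite (@wt_cons Cup i p [::] r) //.
apply/propext; split=> [[ys [u1 [u2 [[_ [x [-> -> ->]]]]]]]|[x h]].
  by rewrite !subr0; exists x.
exists [:: x; bar x], 0, 0; split; last by rewrite !subr0.
by split=> //; exists x.
Qed.

Lemma wt_cap i p (sp : size p = i) x y r w z1 z2 :
  wt ((Cap, i) :: w) (p ++ x :: y :: r) z1 z2 =
  (y = bar x /\ wt w (p ++ r) z1 z2).
Proof.
rewrite (@wt_cons Cap i p [:: x; y] r) //.
apply/propext; split=> [[ys [u1 [u2 [[-> [x' [[-> ->] -> ->]]]]]]]|[-> h]].
  by rewrite !subr0.
exists [::], 0, 0; split; last by rewrite !subr0.
by split=> //; exists x.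
Qed.

Lemma wt_crossS i p (sp : size p = i) c d x y r w z1 z2 :
  wt ((Cross c, i.+1) :: w) (p ++ d :: x :: y :: r) z1 z2 =
  wt w (p ++ d :: pass c y x (- ori x.1) :: pass c x y (ori y.1) :: r)
    (z1 - span_weight c x y) (z2 - self_weight c x y).
Proof. by rewrite -!(cat_rcons d p) wt_cross // size_rcons sp. Qed.

Lemma wt_cupS i p (sp : size p = i) d r w z1 z2 :
  wt ((Cup, i.+1) :: w) (p ++ d :: r) z1 z2 =
  exists x, wt w (p ++ d :: x :: bar x :: r) z1 z2.
Proof.
rewrite -!(cat_rcons d p) wt_cup ?size_rcons ?sp //.
by under eq_exists do rewrite cat_rcons.
Qed.

Lemma wt_capS i p (sp : size p = i) d x y r w z1 z2 :
  wt ((Cap, i.+1) :: w) (p ++ d :: x :: y :: r) z1 z2 =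
  (y = bar x /\ wt w (p ++ d :: r) z1 z2).
Proof. by rewrite -!(cat_rcons d p) wt_cap // size_rcons sp. Qed.

Lemma split_at (T : Type) (n i : nat) (s : seq T) : (i + n <= size s)%N ->
  exists p xs r, [/\ s = p ++ xs ++ r, size p = i & size xs = n].
Proof.
move=> le; exists (take i s), (take n (drop i s)), (drop n (drop i s)).
rewrite !cat_take_drop size_takel ?size_takel ?size_drop //; first lia.
exact: leq_trans (leq_addr _ _) le.
Qed.

(** * Invariance of the weights under the moves *)

Hypothesis f0 : f 0 = 0.

Lemma wt_height a b i d v s z1 z2 :
  (i + nin a + d + nin b <= size s)%N ->
  wt [:: (a, i), (b, i + nout a + d)%N & v] s z1 z2 =
  wt [:: (b, i + nin a + d)%N, (a, i) & v] s z1 z2.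
Proof.
move=> /split_at [q [ys [r [-> sq sy]]]].
have /split_at[p [xs [t [eq sp sx]]]] : (i + nin a <= size q)%N by lia.
move: sq; rewrite eq !size_cat sp sx => st.
have {}st : size t = d by lia.
have ea : forall ys, (p ++ xs ++ t) ++ ys ++ r = p ++ xs ++ t ++ ys ++ r.
  by move=> ys'; rewrite -!catA.
rewrite ea (@wt_cons a i p) // -ea (@wt_cons b _ (p ++ xs ++ t)) //; last first.
  by rewrite !size_cat sp sx st addnA.
apply/propext; split.
  move=> [xs' [u1 [u2 [h1]]]].
  have sxs := act_size h1.
  have -> : p ++ xs' ++ t ++ ys ++ r = (p ++ xs' ++ t) ++ ys ++ r.
    by rewrite -!catA.
  rewrite (@wt_cons b) //; last by rewrite !size_cat sp sxs st addnA.
  move=> [ys' [v1 [v2 [h2 h]]]]; exists ys', v1, v2; split=> //.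
  rewrite ea (@wt_cons a _ p) //; exists xs', u1, u2; split=> //.
  by move: h; rewrite -!catA ![_ - u1 - _]addrAC ![_ - u2 - _]addrAC.
move=> [ys' [v1 [v2 [h2]]]]; rewrite ea (@wt_cons a _ p) //.
move=> [xs' [u1 [u2 [h1 h]]]]; exists xs', u1, u2; split=> //.
have sxs := act_size h1.
have -> : p ++ xs' ++ t ++ ys ++ r = (p ++ xs' ++ t) ++ ys ++ r.
  by rewrite -!catA.
rewrite (@wt_cons b) //; last by rewrite !size_cat sp sxs st addnA.
exists ys', v1, v2; split=> //.
by move: h; rewrite -!catA ![_ - v1 - _]addrAC ![_ - v2 - _]addrAC.
Qed.

Lemma split_at2 (T : Type) (i : nat) (s : seq T) : (i + 2 <= size s)%N ->
  exists p x y r, s = p ++ [:: x, y & r] /\ size p = i.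
Proof.
case/split_at=> p [[|x [|y [|? ?]]] [r [-> sp]]] // _.
by exists p, x, y, r.
Qed.

Lemma split_at3 (T : Type) (i : nat) (s : seq T) : (i + 3 <= size s)%N ->
  exists p x y z r, s = p ++ [:: x, y, z & r] /\ size p = i.
Proof.
case/split_at=> p [[|x [|y [|z [|? ?]]]] [r [-> sp]]] // _.
by exists p, x, y, z, r.
Qed.

Ltac args := repeat match goal with
  | |- context [f ?x] => match goal with |- context [f ?y] =>
      lazymatch x with y => fail | _ => idtac end;
      replace (f x) with (f y) by (congr f; lia) end end.
Ltac colors := rewrite /pass /span_weight /self_weight /gap /= ?negbK ?oriN ?sgnNl ?sgnNr.
Ltac crunch := congr (wt _ (_ ++ _) _ _); try lia;
  [> match goal with
     | |- @eq (seq color) _ _ => repeat congr (_ :: _); congr (_, Some _); lia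
     | _ => args; try lia
     end ..].

Ltac run sp := rewrite ?(wt_crossS sp, wt_cross sp, wt_capS sp, wt_cap sp).

Lemma wt_RII b i v s z1 z2 : (i + 2 <= size s)%N ->
  wt [:: classical_crossing b i, classical_crossing (~~ b) i & v] s z1 z2 =
  wt v s z1 z2.
Proof.
case/split_at2=> p [x [y [r [-> sp]]]]; rewrite /classical_crossing; run sp.
case: x y => [o [h|]] [o' [h'|]]; colors; rewrite ?(sgnC o' o).
all: crunch.
case: b => /=; args; lia.
Qed.

Lemma wt_VRII i v s z1 z2 : (i + 2 <= size s)%N ->
  wt [:: virtual_crossing i, virtual_crossing i & v] s z1 z2 = wt v s z1 z2.
Proof.
case/split_at2=> p [x [y [r [-> sp]]]]; rewrite /virtual_crossing; run sp.
by case: x y => [o [h|]] [o' [h'|]]; colors; rewrite !subr0.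
Qed.

(** Each crossing has the same difference of levels on both sides: the third strand shifts both
    levels equally or, for the two outer strands, raises the one on one side as much as it lowers
    the other on the other side. *)
Lemma wt_RIII a b c i v s z1 z2 : (i + 3 <= size s)%N ->
  wt [:: classical_crossing a i, classical_crossing b i.+1,
         classical_crossing c i & v] s z1 z2 =
  wt [:: classical_crossing c i.+1, classical_crossing b i,
         classical_crossing a i.+1 & v] s z1 z2.
Proof.
case/split_at3=> p [x [y [z [r [-> sp]]]]]; rewrite /classical_crossing; run sp.
by case: x y z => [o1 [h1|]] [o2 [h2|]] [o3 [h3|]]; colors; crunch.
Qed.

Lemma wt_VRIII i v s z1 z2 : (i + 3 <= size s)%N ->
  wt [:: virtual_crossing i, virtual_crossing i.+1,
         virtual_crossing i & v] s z1 z2 =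
  wt [:: virtual_crossing i.+1, virtual_crossing i,
         virtual_crossing i.+1 & v] s z1 z2.
Proof.
case/split_at3=> p [x [y [z [r [-> sp]]]]]; rewrite /virtual_crossing; run sp.
by case: x y z => [o1 [h1|]] [o2 [h2|]] [o3 [h3|]]; colors; crunch.
Qed.

Lemma wt_SV_3 b i v s z1 z2 : (i + 3 <= size s)%N ->
  wt [:: classical_crossing b i, virtual_crossing i.+1,
         virtual_crossing i & v] s z1 z2 =
  wt [:: virtual_crossing i.+1, virtual_crossing i,
         classical_crossing b i.+1 & v] s z1 z2.
Proof.
case/split_at3=> p [x [y [z [r [-> sp]]]]].
rewrite /virtual_crossing /classical_crossing; run sp.
by case: x y z => [o1 [h1|]] [o2 [h2|]] [o3 [h3|]]; colors; crunch.
Qed.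

Lemma wt_SV_2 b i v s z1 z2 : (i + 3 <= size s)%N ->
  wt [:: virtual_crossing i, classical_crossing b i.+1,
         virtual_crossing i & v] s z1 z2 =
  wt [:: virtual_crossing i.+1, classical_crossing b i,
         virtual_crossing i.+1 & v] s z1 z2.
Proof.
case/split_at3=> p [x [y [z [r [-> sp]]]]].
rewrite /virtual_crossing /classical_crossing; run sp.
by case: x y z => [o1 [h1|]] [o2 [h2|]] [o3 [h3|]]; colors; crunch.
Qed.

Lemma wt_SV_1 b i v s z1 z2 : (i + 3 <= size s)%N ->
  wt [:: virtual_crossing i, virtual_crossing i.+1,
         classical_crossing b i & v] s z1 z2 =
  wt [:: classical_crossing b i.+1, virtual_crossing i,
         virtual_crossing i.+1 & v] s z1 z2.
Proof.
case/split_at3=> p [x [y [z [r [-> sp]]]]].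
rewrite /virtual_crossing /classical_crossing; run sp.
by case: x y z => [o1 [h1|]] [o2 [h2|]] [o3 [h3|]]; colors; crunch.
Qed.

Lemma split_at1 (T : Type) (i : nat) (s : seq T) : (i + 1 <= size s)%N ->
  exists p x r, s = p ++ x :: r /\ size p = i.
Proof.
case/split_at=> p [[|x [|? ?]] [r [-> sp]]] // _.
by exists p, x, r.
Qed.

Lemma wt_zigzag_left i v s z1 z2 : (i + 1 <= size s)%N ->
  wt [:: (Cup, i), (Cap, i.+1) & v] s z1 z2 = wt v s z1 z2.
Proof.
case/split_at1=> p [x [r [-> sp]]]; rewrite (wt_cup sp); apply/propext; split.
  by case=> y; run sp; rewrite barK => -[->].
by move=> h; exists x; run sp; rewrite barK.
Qed.

Lemma wt_zigzag_right i v s z1 z2 : (i + 1 <= size s)%N ->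
  wt [:: (Cup, i.+1), (Cap, i) & v] s z1 z2 = wt v s z1 z2.
Proof.
case/split_at1=> p [x [r [-> sp]]]; rewrite (wt_cupS sp); apply/propext; split.
  by case=> y; run sp => -[-> h]; rewrite barK in h.
by move=> h; exists (bar x); run sp; rewrite barK.
Qed.

Lemma wt_VRI_cap i v s z1 z2 : (i + 2 <= size s)%N ->
  wt [:: virtual_crossing i, (Cap, i) & v] s z1 z2 = wt ((Cap, i) :: v) s z1 z2.
Proof.
case/split_at2=> p [x [y [r [-> sp]]]]; rewrite /virtual_crossing; run sp.
case: x y => [o1 h1] [o2 h2]; colors; rewrite !subr0; apply/propext.
by split=> -[[-> ->] ?]; rewrite /bar /= negbK.
Qed.

Lemma wt_VRI_cup i v s z1 z2 : (i <= size s)%N ->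
  wt [:: (Cup, i), virtual_crossing i & v] s z1 z2 = wt ((Cup, i) :: v) s z1 z2.
Proof.
rewrite -{1}[i]addn0 => /split_at[p [[|? ?] [r [-> sp // _]]]].
rewrite !(wt_cup sp); apply/propext.
split=> -[[o h]]; rewrite /virtual_crossing; run sp; colors.
  by rewrite !subr0 => ?; exists (~~ o, h); rewrite /bar /= negbK.
by move=> ?; exists (~~ o, h); run sp; colors; rewrite !subr0.
Qed.

(** The two strands of a curl have opposite orientations, so their levels are shifted alike and
    their [gap] is 0, where [f] vanishes. *)
Lemma wt_RI_cap b i v s z1 z2 : (i + 2 <= size s)%N ->
  wt [:: classical_crossing b i, (Cap, i) & v] s z1 z2 = wt ((Cap, i) :: v) s z1 z2.
Proof.
case/split_at2=> p [x [y [r [-> sp]]]]; rewrite /classical_crossing; run sp.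
case: x y => [o1 [h1|]] [o2 [h2|]]; colors; apply/propext.
- have gap0 : o1 = ~~ o2 -> h1 = h2 -> (h1 - h2) * 2 + ori o1 + ori o2 = 0.
    by move=> -> ->; rewrite oriN; lia.
  split=> -[[eo eh]].
    have {}eo : o1 = ~~ o2 by rewrite eo.
    have {}eh : h1 = h2 by move: eh; rewrite eo oriN; lia.
    rewrite gap0 // eo eh oppr0 f0 oppr0 if_same mulr0 !subr0 => h.
    by rewrite /bar /= negbK.
  have {}eo : o1 = ~~ o2 by rewrite eo /= negbK.
  rewrite gap0 // eo eh oppr0 f0 oppr0 if_same mulr0 !subr0 => h.
  by rewrite /bar /= oriN opprK.
- by split=> -[].
- by split=> -[].
by rewrite !subr0; split=> -[[->] ?]; rewrite /bar /= negbK.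
Qed.

Lemma wt_RI_cup b i v s z1 z2 : (i <= size s)%N ->
  wt [:: (Cup, i), classical_crossing b i & v] s z1 z2 = wt ((Cup, i) :: v) s z1 z2.
Proof.
rewrite -{1}[i]addn0 => /split_at[p [[|? ?] [r [-> sp // _]]]].
rewrite !(wt_cup sp); apply/propext.
have gap0 o (h : int) : (h - h) * 2 + ori o + ori (~~ o) = 0 by rewrite oriN; lia.
have self0 o o' (h : int) :
    sgn o o' * (if b then f ((h - h) * 2 + ori o + ori (~~ o)) else
      - f (- ((h - h) * 2 + ori o + ori (~~ o)))) = 0.
  by rewrite gap0 oppr0 f0 oppr0 if_same mulr0.
split=> -[[o [h|]]]; rewrite /classical_crossing.
- run sp; rewrite /self_weight /gap /= self0 /span_weight /pass /= !subr0 oriN => ?.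
  by exists (~~ o, Some (h - ori o)); rewrite /bar /= negbK.
- run sp; colors; rewrite !subr0 => ?; exists (~~ o, None).
  by rewrite /bar /= negbK.
- move=> ?; exists (~~ o, Some (h + ori (~~ o))); run sp.
  rewrite /self_weight /gap /= self0 /span_weight /pass /= !subr0.
  by rewrite negbK oriN opprK !subrK.
- by move=> ?; exists (~~ o, None); run sp; colors; rewrite !subr0.
Qed.

Ltac same H := refine (eq_ind _ (fun P => P) H _ _).

(** The turned crossing has the opposite [sgn], marking and [gap], and its strands exchange left and
    right; in both weights these changes cancel. *)
Lemma wt_swing_cap c i v s z1 z2 : (i + 3 <= size s)%N ->
  wt [:: (Cross c, i), (Cap, i.+1) & v] s z1 z2 =
  wt [:: (Cross (flip c), i.+1), (Cap, i) & v] s z1 z2.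
Proof.
case/split_at3=> p [x [y [z [r [-> sp]]]]]; run sp; apply/propext.
split=> -[]; case: x y z c => [o [h|]] [o' [h'|]] [o'' [h''|]] [b|]; colors=> //.
all: move=> E H; case: E => *; subst; rewrite ?oriN ?sgnNr ?(sgnC o' o) in H *; split.
all: try by rewrite // /bar /=; congr (_, Some _); lia.
all: try exact: H.
all: same H; crunch.
all: by case: b {H} => /=; args; lia.
Qed.

Lemma wt_swing_cup c i v s z1 z2 : (i + 1 <= size s)%N ->
  wt [:: (Cup, i), (Cross c, i.+1) & v] s z1 z2 =
  wt [:: (Cup, i.+1), (Cross (flip c), i) & v] s z1 z2.
Proof.
case/split_at1=> p [x [r [-> sp]]]; rewrite (wt_cup sp) (wt_cupS sp).
apply/propext; split=> -[y H].
(* The strand now born at the minimum meets [x] before it reaches the place of [y], so it starts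
   with the level that this crossing turns into that of [y]. *)
{ exists (pass c y x (ori x.1)); move: H; run sp.
  case: x y c => [o [h|]] [o' [h'|]] [b|]; rewrite /bar;
    colors; rewrite ?(sgnC o' o) => H.
  all: try exact: H.
  all: same H; crunch.
  by case: b {H} => /=; args; lia. }
exists (pass c y x (- ori x.1)); move: H; run sp.
case: x y c => [o [h|]] [o' [h'|]] [b|]; rewrite /bar;
    colors; rewrite ?(sgnC o' o) => H.
all: try exact: H.
all: same H; crunch.
by case: b {H} => /=; args; lia.
Qed.

Lemma wt_local l r v s z1 z2 : local_move l r ->
  closes (size s) (l ++ v) -> closes (size s) (r ++ v) ->
  wt (l ++ v) s z1 z2 = wt (r ++ v) s z1 z2.
Proof.
case; rewrite /classical_crossing /virtual_crossing /=.
- by move=> a b i d ? ?; apply: wt_height; lia.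
- by move=> i ? ?; apply: wt_zigzag_left; lia.
- by move=> i ? ?; apply: wt_zigzag_right; lia.
- by move=> c i ? ?; apply: wt_swing_cap; lia.
- by move=> c i ? ?; apply: wt_swing_cup; lia.
- by move=> b i ? ?; apply: wt_RI_cap; lia.
- by move=> b i ? ?; apply: wt_RI_cup; lia.
- by move=> b i ? ?; apply: wt_RII; lia.
- by move=> a b c i ? ? ?; apply: wt_RIII; lia.
- by move=> i ? ?; apply: wt_VRI_cap; lia.
- by move=> i ? ?; apply: wt_VRI_cup; lia.
- by move=> i ? ?; apply: wt_VRII; lia.
- by move=> i ? ?; apply: wt_VRIII; lia.
- by move=> b i ? ?; apply: wt_SV_3; lia.
- by move=> b i ? ?; apply: wt_SV_2; lia.
- by move=> b i ? ?; apply: wt_SV_1; lia.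
Qed.

Lemma wt_context l r u v s z1 z2 : local_move l r ->
  closes (size s) (u ++ l ++ v) -> closes (size s) (u ++ r ++ v) ->
  wt (u ++ l ++ v) s z1 z2 = wt (u ++ r ++ v) s z1 z2.
Proof.
move=> lr; elim: u s z1 z2 => [|[a i] u IH] s z1 z2 /=; first exact: wt_local.
move=> /andP[le cl] /andP[_ cr].
have [p [xs [q [es sp sx]]]] := split_at le; move: es cl cr => ->.
rewrite !(@wt_cons a i p xs) // !size_cat sp sx => cl cr.
apply: eq_exists => ys; apply: eq_exists => u1; apply: eq_exists => u2.
apply/propext; split=> -[ha]; [rewrite IH|rewrite -IH] => //;
  rewrite !size_cat (act_size ha) sp.
all: by [apply: etrans cl; congr closes; lia|apply: etrans cr; congr closes; lia].
Qed.

Lemma wt_equivalent w w' z1 z2 : equivalent w w' ->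
  wt w [::] z1 z2 = wt w' [::] z1 z2.
Proof.
elim=> {w w'} [w w' [u v l r lr cl cr]|//|w w' _ //|w w' w'' _ -> _ //].
exact: wt_context.
Qed.

End Coloring.

(** * Effect of crossing changes and virtualizations on the weights *)

Lemma wt_trivial g f k z1 z2 :
  wt g f (trivial_diagram k) [::] z1 z2 -> z1 = 0 /\ z2 = 0.
Proof.
rewrite /trivial_diagram; elim: k => [[]//|k IH].
rewrite [flatten _]/= (@wt_cup _ _ 0 [::] erefl [::]) => -[x].
by rewrite (@wt_cap _ _ 0 [::] erefl x _ [::]) => -[_ /IH].
Qed.

(** The levels do not see the marking, so the same coloring fits [w']; a changed crossing only
    trades [f t] for [- f (- t)] or conversely. *)
Lemma wt_change g f : (forall t, `|f t + f (- t)| <= 1) ->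
  forall m w w', alter 0 m w w' -> forall s z1 z2, wt g f w s z1 z2 ->
  exists2 z2', wt g f w' s z1 z2' & `|z2 - z2'| <= m%:Z.
Proof.
move=> fN m w w' aw; remember 0%N as n eqn:en; elim: aw en => {n m w w'} //.
- by move=> _ s z1 z2 /= [-> -> ->]; exists 0 => //; rewrite subrr.
- move=> n m w w' [a i] _ IH en s z1 z2 [ys [u1 [u2 [ha /(IH en)[z2' h le]]]]].
  exists (z2' + u2); last by lia.
  by exists ys, u1, u2; rewrite addrK.
- move=> n m w w' b i _ IH en s z1 z2.
  move=> [ys [u1 [u2 [[x [y [exy -> -> ->]]] /(IH en)[z2' h le]]]]].
  exists (z2' + self_weight g f (Classical (~~ b)) x y).
    do 3 eexists; split; first by exists x, y; split.
    by rewrite addrK.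
  move: le; rewrite /self_weight; clear -fN.
  case: x y => [o [hx|]] [o' [hy|]] /=; try lia.
  move: (fN (gap g (o, Some hx) (o', Some hy))); rewrite /sgn.
  by case: b; case: (o == o') => /=; lia.
Qed.

(** What survives the virtualization of a crossing of two levelled strands: the classes, with all
    levels collapsed to 0 to match jumps of height 0. *)
Definition erase (x : color) : color := (x.1, omap (fun=> 0) x.2).

Lemma map_erase_cat (i j : nat) (s ys : seq color) :
  map erase (take i s ++ ys ++ drop j s) =
  take i (map erase s) ++ map erase ys ++ drop j (map erase s).
Proof. by rewrite !map_cat map_take map_drop. Qed.

Lemma act_erase g f a xs ys u1 u2 : act g f a xs ys u1 u2 ->
  act 0 (fun=> 0) a (map erase xs) (map erase ys) u1 0.
Proof.
case: a => [||c] /=.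
- by move=> [-> [x [-> -> _]]]; split=> //; exists (erase x).
- by move=> [-> [x [-> -> _]]]; split=> //; exists (erase x).
move=> [x [y [-> -> -> _]]]; exists (erase x), (erase y).
rewrite /ori oppr0 !if_same.
case: x y c => [o [hx|]] [o' [hy|]] [b|]; split=> //.
by rewrite /self_weight /= oppr0 if_same mulr0.
Qed.

Lemma wt_act_erase g f a i w s ys u1 u2 z1 :
  act g f a (take (nin a) (drop i s)) ys u1 u2 ->
  wt 0 (fun=> 0) w (map erase (take i s ++ ys ++ drop (i + nin a) s)) z1 0 ->
  wt 0 (fun=> 0) ((a, i) :: w) (map erase s) (z1 + u1) 0.
Proof.
move=> /act_erase ha h; exists (map erase ys), u1, 0.
by rewrite addrK subr0 -map_erase_cat -map_drop -map_take.
Qed.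

Lemma wt_erase g f w s z1 z2 : wt g f w s z1 z2 ->
  wt 0 (fun=> 0) w (map erase s) z1 0.
Proof.
elim: w s z1 z2 => [|[a i] w IH] s z1 z2; first by case=> -> ->.
move=> [ys [u1 [u2 [ha /IH h]]]].
by have := wt_act_erase ha h; rewrite subrK.
Qed.

(** With jumps of height 0 a coloring survives every virtualization, which costs only the span
    weight of that crossing, at most 1. *)
Lemma wt_alter_erased n m w w' : alter n m w w' ->
  forall s z1 z2, wt 0 (fun=> 0) w s z1 z2 ->
  exists2 z1', wt 0 (fun=> 0) w' s z1' z2 & `|z1 - z1'| <= n%:Z.
Proof.
elim=> {n m w w'} /=.
- by move=> s z1 z2 [-> -> ->]; exists 0; rewrite ?subrr.
- move=> n m w w' [a i] _ IH s z1 z2 [ys [u1 [u2 [ha /IH[z1' h le]]]]].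
  exists (z1' + u1); last by lia.
  by exists ys, u1, u2; rewrite addrK.
- move=> n m w w' b i _ IH s z1 z2 [ys [u1 [u2 [[x [y [exy -> -> ->]]] /IH[z1' h le]]]]].
  exists z1'; last first.
    move: le; clear; case: x y => [o [hx|]] [o' [hy|]]; rewrite /= /sgn /=;
    by case: (o == o'); lia.
  exists [:: pass Virtual y x (- ori 0 x.1); pass Virtual x y (ori 0 y.1)], 0, 0.
  split; first by exists x, y; split.
  rewrite !subr0 /self_weight; move: h; clear; rewrite /ori oppr0 !if_same.
  by case: x y => [o [hx|]] [o' [hy|]];
    rewrite /pass /= ?addr0 /self_weight /= ?oppr0 ?if_same ?mulr0 ?subr0.
move=> n m w w' b i _ IH s z1 z2 [ys [u1 [u2 [[x [y [exy -> -> ->]]] /IH[z1' h le]]]]].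
exists (z1' + span_weight (Classical (~~ b)) x y); last first.
  by move: le; rewrite /span_weight; lia.
do 3 eexists; split; first by exists x, y; split.
rewrite addrK; move: h; clear; rewrite /pass /self_weight.
by case: x y => [o [hx|]] [o' [hy|]]; rewrite /= ?oppr0 ?if_same.
Qed.

(* Virtualizing a crossing between different classes moves the span by one;
   virtualizing any other crossing loses the levels, but not the span. *)
Lemma wt_alter f n m w w' : (forall t, f (- t) = - f t) -> alter n m w w' ->
  forall s z1 z2, wt 1 f w s z1 z2 ->
  (exists2 z1', wt 1 f w' s z1' z2 & `|z1 - z1'| <= n%:Z) \/
  (exists2 z1', wt 0 (fun=> 0) w' (map erase s) z1' 0 & `|z1 - z1'| < n%:Z).
Proof.
move=> fN; elim=> {n m w w'}.
- by move=> s z1 z2 [-> -> ->]; left; exists 0; rewrite ?subrr.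
- move=> n m w w' [a i] aw IH s z1 z2 [ys [u1 [u2 [ha h]]]].
  case/IH: (h) => [[z1' h' le]|[z1' h' lt]]; [left|right].
    exists (z1' + u1); last by lia.
    by exists ys, u1, u2; rewrite addrK.
  by exists (z1' + u1); [exact: (wt_act_erase ha h') | lia].
- move=> n m w w' b i aw IH s z1 z2 [ys [u1 [u2 [[x [y [exy -> -> ->]]] h]]]].
  have [xy|xy] := boolP (x.2 && y.2); last first.
    have [e1 e2 e3 e4] : [/\ pass (Classical b) x y (ori 1 y.1) = x,
        pass (Classical b) y x (- ori 1 x.1) = y,
        self_weight 1 f (Classical b) x y = 0 &
        `|span_weight (Classical b) x y| <= 1].
      move: xy; clear; rewrite /span_weight /sgn.
      by case: x y => [o [hx|]] [o' [hy|]] //=; case: (o == o').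
    move: h; rewrite e1 e2 e3 subr0 => /IH[[z1' h' le]|[z1' h' lt]]; [left|right].
      exists z1'; last by lia.
      exists [:: y; x], 0, 0; rewrite !subr0; split=> //.
      by exists x, y; split=> //; case: (x) (y) => [? [?|]] [? [?|]].
    exists z1'; last by lia.
    rewrite -[z1']addr0; apply: (@wt_act_erase 1 f (Cross Virtual) i w' s
      [:: y; x] 0 0 z1') => //.
    by exists x, y; split=> //; case: (x) (y) => [? [?|]] [? [?|]].
  (* A crossing of two levelled strands has span weight 0, so this virtualization is spent without
     moving the span; hence the strict bound. *)
  right; have [z1' h' le] := wt_alter_erased aw (wt_erase h).
  exists z1'; last first.
    by move: le xy; rewrite /span_weight; case: (x.2) (y.2) => [?|] [?|] //=; lia.
  rewrite -[z1']addr0; apply: (@wt_act_erase 1 f (Cross Virtual) i w' s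
    [:: y; x] 0 0 z1').
    by exists x, y; split=> //; case: (x) (y) => [? [?|]] [? [?|]].
  by move: h' xy; rewrite !map_cat; case: (x) (y) => [? [?|]] [? [?|]].
move=> n m w w' b i aw IH s z1 z2 [ys [u1 [u2 [[x [y [exy -> -> ->]]] h]]]].
have e : self_weight 1 f (Classical (~~ b)) x y = self_weight 1 f (Classical b) x y.
  by case: (x) (y) => [? [?|]] [? [?|]] //; case: (b); rewrite /self_weight /= fN ?opprK.
case/IH: (h) => [[z1' h' le]|[z1' h' lt]]; [left|right].
  exists (z1' + span_weight (Classical b) x y); last by lia.
  do 3 eexists; split; first by exists x, y; split.
  by rewrite e addrK.
exists (z1' + span_weight (Classical b) x y); last by lia.
apply: (@wt_act_erase 1 f (Cross (Classical (~~ b))) i w' s _ _ _ z1' _ h').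
by exists x, y; split.
Qed.

(** * Simplification of words inside a diagram *)

(** Directed, so that closedness, which [move] demands at both ends, is carried along the
    reduction. *)
Definition reduces (l r : word) : Prop := forall u v,
  is_closed (u ++ l ++ v) ->
  is_closed (u ++ r ++ v) /\ equivalent (u ++ l ++ v) (u ++ r ++ v).

Lemma reduces_refl l : reduces l l.
Proof. by move=> u v ?; split=> //; apply: rst_refl. Qed.

Lemma reduces_trans l' l r : reduces l l' -> reduces l' r -> reduces l r.
Proof.
move=> h h' u v /h[/h'[? e'] e]; split=> //; exact: rst_trans e e'.
Qed.

Lemma reduces_cat l l' r r' :
  reduces l l' -> reduces r r' -> reduces (l ++ r) (l' ++ r').
Proof.
move=> h h'; apply: (@reduces_trans (l' ++ r)).
  by move=> u v; rewrite -!catA; apply: h.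
by move=> u v; rewrite -!catA !(catA u); apply: h'.
Qed.

Lemma closes_cat l r u v : (forall N, closes N (l ++ v) -> closes N (r ++ v)) ->
  forall N, closes N (u ++ l ++ v) -> closes N (u ++ r ++ v).
Proof.
by move=> h; elim: u => [//|[a i] u IH] N /= /andP[-> /IH].
Qed.

Lemma move_reduces l r : local_move l r \/ local_move r l ->
  (forall N v, closes N (l ++ v) -> closes N (r ++ v)) -> reduces l r.
Proof.
move=> h cl u v cw; have cw' := @closes_cat l r u v (cl ^~ v) 0 cw.
split=> //; case: h => h; first exact/rst_step/Move.
exact/rst_sym/rst_step/Move.
Qed.

Ltac closing := let c := fresh "c" in
  move=> ? ?; rewrite /classical_crossing /virtual_crossing /=; intro c;
  repeat match type of c with is_true (_ && _) => move: c => /andP[? c] end;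
  repeat (apply/andP; split); try lia; try by apply: etrans c; congr closes; lia.

Lemma reduces_RII b i :
  reduces [:: classical_crossing b i; classical_crossing (~~ b) i] [::].
Proof. by apply: move_reduces; [left; constructor|closing]. Qed.

Lemma reduces_VRII i : reduces [:: virtual_crossing i; virtual_crossing i] [::].
Proof. by apply: move_reduces; [left; constructor|closing]. Qed.

Lemma reduces_VRI_cup i : reduces [:: (Cup, i); virtual_crossing i] [:: (Cup, i)].
Proof. by apply: move_reduces; [left; constructor|closing]. Qed.

Lemma reduces_zigzag_right i : reduces [:: (Cup, i.+1); (Cap, i)] [::].
Proof. by apply: move_reduces; [left; constructor|closing]. Qed.

Lemma reduces_swing_cap c i :
  reduces [:: (Cross c, i); (Cap, i.+1)] [:: (Cross (flip c), i.+1); (Cap, i)].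
Proof. by apply: move_reduces; [left; constructor|closing]. Qed.

Lemma reduces_height a b i d :
  reduces [:: (a, i); (b, i + nout a + d)%N] [:: (b, i + nin a + d)%N; (a, i)].
Proof. by apply: move_reduces; [left; constructor|closing]. Qed.

Lemma reduces_height_sym a b i d :
  reduces [:: (b, i + nin a + d)%N; (a, i)] [:: (a, i); (b, i + nout a + d)%N].
Proof. by apply: move_reduces; [right; constructor|closing]. Qed.

Lemma reduces_in u v l r : reduces l r -> reduces (u ++ l ++ v) (u ++ r ++ v).
Proof.
by move=> h; do 2?[apply: reduces_cat => //]; apply: reduces_refl.
Qed.

(** * Twists, their cancellation, and closures of virtual braids *)

Definition power (n : nat) (w : word) : word := flatten (nseq n w).

Lemma powerS n w : power n.+1 w = w ++ power n w.
Proof. by []. Qed.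

Lemma powerSr n w : power n.+1 w = power n w ++ w.
Proof. by elim: n => [|n IH]; rewrite /power /= ?cats0 // -catA -IH. Qed.

Lemma reduces_power n w : reduces w [::] -> reduces (power n w) [::].
Proof.
move=> h; elim: n => [|n IH]; first exact: reduces_refl.
exact: (reduces_cat h IH).
Qed.

Definition twist (i : nat) : word :=
  [:: classical_crossing true i; virtual_crossing i].

Definition untwist (i : nat) : word :=
  [:: virtual_crossing i; classical_crossing false i].

Definition clasp (i : nat) : word :=
  [:: classical_crossing true i; classical_crossing true i].

(** Cancellation starts in the middle, where the last twist meets the first untwist as
    [s v v s^-1]. *)
Lemma reduces_untwist n i : reduces (power n (twist i) ++ power n (untwist i)) [::].
Proof.
elim: n => [|n IH]; first exact: reduces_refl.
rewrite [power _ (twist i)]powerSr -catA; apply: (reduces_trans _ IH); apply: reduces_cat.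
  exact: reduces_refl.
apply: (@reduces_trans [:: classical_crossing true i,
  classical_crossing false i & power n (untwist i)]).
  exact: (@reduces_in [:: classical_crossing true i]
    (classical_crossing false i :: power n (untwist i)) _ _ (@reduces_VRII i)).
exact: (@reduces_in [::] _ _ _ (@reduces_RII true i)).
Qed.

(** The crossing swings across the inner maximum onto the inner minimum, where it is a curl; its
    removal leaves a zigzag. *)
Lemma reduces_closure2 i :
  reduces [:: (Cup, i); (Cup, i.+1); virtual_crossing i; (Cap, i.+1); (Cap, i)]
          [:: (Cup, i); (Cap, i)].
Proof.
apply: reduces_trans (@reduces_in [:: _; _] [:: _] _ _
  (@reduces_swing_cap Virtual i)) _.
apply: reduces_trans (@reduces_in [:: _] [:: _; _] _ _ (@reduces_VRI_cup i.+1)) _.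
exact: (@reduces_in [:: _] [:: _] _ _ (@reduces_zigzag_right i)).
Qed.

(** The same swing, after exchanges of height with the other crossing, removes the third strand. *)
Lemma reduces_closure3 i :
  reduces [:: (Cup, i); (Cup, i.+1); (Cup, i.+2); virtual_crossing i;
              virtual_crossing i.+1; (Cap, i.+2); (Cap, i.+1); (Cap, i)]
          [:: (Cup, i); (Cap, i)].
Proof.
apply: reduces_trans (@reduces_in [:: _; _; _; _] [:: _; _] _ _
  (@reduces_swing_cap Virtual i.+1)) _.
have := @reduces_height (Cross Virtual) (Cross Virtual) i 0.
rewrite /= !addn0 addn2 => h.
apply: reduces_trans (@reduces_in [:: _; _; _] [:: _; _; _] _ _ h) _ => {h}.
apply: reduces_trans (@reduces_in [:: _; _] [:: _; _; _; _] _ _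
  (@reduces_VRI_cup i.+2)) _.
have := @reduces_height_sym (Cross Virtual) Cup i 0.
rewrite /= !addn0 addn2 => h.
apply: reduces_trans (@reduces_in [:: _; _] [:: _; _; _] _ _ h) _ => {h}.
apply: reduces_trans (@reduces_in [:: _; _; _] [:: _; _] _ _
  (@reduces_zigzag_right i.+1)) _.
exact: reduces_closure2.
Qed.

Lemma reduces_unlink :
  reduces [:: (Cup, 0); (Cup, 2); (Cap, 2); (Cap, 0)]%N (trivial_diagram 2).
Proof.
apply: reduces_trans (@reduces_in [:: _; _] [::] _ _
  (@reduces_height_sym Cap Cap 0 0)) _.
exact: (@reduces_in [:: _] [:: _] _ _ (@reduces_height_sym Cap Cup 0 0)).
Qed.

Lemma alter_refl w : alter 0 0 w w.
Proof. by elim: w => [|x w IH]; constructor. Qed.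

Lemma alter_cat n m w w' n' m' u u' : alter n m w w' -> alter n' m' u u' ->
  alter (n + n') (m + m') (w ++ u) (w' ++ u').
Proof. by move=> h h'; elim: h => //= *; constructor. Qed.

Lemma alter_power n m j w w' : alter n m w w' ->
  alter (j * n) (j * m) (power j w) (power j w').
Proof.
by move=> h; elim: j => [|j IH]; [constructor | rewrite !mulSn; apply: alter_cat].
Qed.

Lemma closes_power N n w v : (forall v, closes N (w ++ v) = closes N v) ->
  closes N (power n w ++ v) = closes N v.
Proof. by move=> h; elim: n => [//|n IH]; rewrite /power /= -catA h. Qed.

Lemma circles_power s fresh n w v :
  (forall v, circles fresh s (w ++ v) = circles fresh s v) ->
  circles fresh s (power n w ++ v) = circles fresh s v.
Proof. by move=> h; elim: n => [//|n IH]; rewrite /power /= -catA h. Qed.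

Lemma closes_trivial k : closes 0 (trivial_diagram k).
Proof. by elim: k. Qed.

Lemma circles_trivial k fresh : circles fresh [::] (trivial_diagram k) = k.
Proof. by elim: k fresh => [//|k IH] fresh /=; rewrite eqxx IH. Qed.

(** * The two families of diagrams and how they are undone *)

Definition clasp_word (m p k : nat) : word :=
  [:: (Cup, 0); (Cup, 1)]%N ++
  (power p (twist 0) ++ power m (clasp 0) ++ power p (untwist 0)) ++
  [:: virtual_crossing 0; (Cap, 1); (Cap, 0)]%N ++
  trivial_diagram k.

Lemma clasp_word_closed m p k : is_closed (clasp_word m p k).
Proof.
rewrite /is_closed /clasp_word /= -!catA; do !rewrite closes_power //=.
exact: closes_trivial.
Qed.

Lemma clasp_word_components m p k : component_count (clasp_word m p k) = k.+1.
Proof.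
by rewrite /component_count /clasp_word /= -!catA; do !rewrite circles_power //=;
  rewrite circles_trivial.
Qed.

Lemma reduces_conj n i w : reduces w [::] ->
  reduces (power n (twist i) ++ w ++ power n (untwist i)) [::].
Proof.
by move=> h; apply: reduces_trans (@reduces_in _ _ _ _ h) _; apply: reduces_untwist.
Qed.

Lemma reduces_equivalent w w' : is_closed w -> reduces w w' -> equivalent w w'.
Proof. by move=> c /(_ [::] [::]); rewrite /= !cats0 => /(_ c) []. Qed.

Lemma clasp_word_unlink m p k : exists2 w,
  alter 0 m (clasp_word m p k) w & equivalent w (trivial_diagram k.+1).
Proof.
pose untied := [:: classical_crossing true 0; classical_crossing false 0].
exists ([:: (Cup, 0); (Cup, 1)]%N ++ (power p (twist 0) ++ power m untied ++
  power p (untwist 0)) ++ [:: virtual_crossing 0; (Cap, 1); (Cap, 0)]%N ++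
  trivial_diagram k).
  have change : alter 0 1 (clasp 0) untied by do !constructor.
  have := alter_cat (alter_refl _) (alter_cat (alter_cat (alter_refl (power p (twist 0)))
    (alter_cat (alter_power m change) (alter_refl _))) (alter_refl _)).
  by rewrite !add0n !addn0 muln0 muln1; apply.
apply: reduces_equivalent.
  rewrite /is_closed /= -!catA; do !rewrite closes_power //=; exact: closes_trivial.
apply: reduces_trans (@reduces_in _ _ _ _
  (@reduces_conj _ _ _ (@reduces_power _ _ (@reduces_RII _ _)))) _.
apply: (@reduces_cat _ [:: _; _] _ _ (@reduces_closure2 0)).
exact: reduces_refl.
Qed.

(* The first circle lies to the left of the closure of a braid on the strands
   2, 3, 4; its strand 1 is twisted with the strand 2. *)
Definition span_word (n p k : nat) : word :=
  [:: (Cup, 0); (Cup, 2); (Cup, 3); (Cup, 4)]%N ++ power n (twist 1) ++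
  (power p (twist 2) ++ twist 3 ++ power p (untwist 2)) ++
  [:: virtual_crossing 2; virtual_crossing 3; (Cap, 4); (Cap, 3); (Cap, 2); (Cap, 0)]%N ++
  trivial_diagram k.

Lemma span_word_closed n p k : is_closed (span_word n p k).
Proof.
rewrite /is_closed /span_word /= -!catA; do !rewrite closes_power //=.
exact: closes_trivial.
Qed.

Lemma span_word_components n p k : component_count (span_word n p k) = k.+2.
Proof.
by rewrite /component_count /span_word /= -!catA; do !rewrite circles_power //=;
  rewrite circles_trivial.
Qed.

Lemma span_word_unlink n p k : exists2 w,
  alter n.+1 0 (span_word n p k) w & equivalent w (trivial_diagram k.+2).
Proof.
pose vv i := [:: virtual_crossing i; virtual_crossing i].
exists ([:: (Cup, 0); (Cup, 2); (Cup, 3); (Cup, 4)]%N ++ power n (vv 1%N) ++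
  (power p (twist 2) ++ vv 3 ++ power p (untwist 2)) ++
  [:: virtual_crossing 2; virtual_crossing 3; (Cap, 4); (Cap, 3); (Cap, 2); (Cap, 0)]%N ++
  trivial_diagram k).
  have virt : alter 1 0 (twist 3) (vv 3) by do !constructor.
  have virt' : alter 1 0 (twist 1) (vv 1%N) by do !constructor.
  have := alter_cat (alter_refl _) (alter_cat (alter_power n virt') (alter_cat
    (alter_cat (alter_refl (power p (twist 2))) (alter_cat virt (alter_refl _)))
    (alter_refl _))).
  by rewrite !add0n !addn0 muln0 muln1 addn1; apply.
apply: reduces_equivalent.
  rewrite /is_closed /= -!catA; do !rewrite closes_power //=; exact: closes_trivial.
apply: reduces_trans (@reduces_in _ _ _ _ (@reduces_power _ _ (@reduces_VRII _))) _.
have h : reduces (vv 3) [::] by exact: reduces_VRII.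
apply: reduces_trans (@reduces_in _ _ _ _ (@reduces_conj p 2 _ h)) _.
apply: reduces_trans (@reduces_in [:: _] (_ :: _) _ _ (@reduces_closure3 2)) _.
apply: (@reduces_cat _ _ _ _ reduces_unlink).
exact: reduces_refl.
Qed.

(** * Weights of runs of twists and clasps *)

Arguments wt : simpl never.

(** Here [t] is twice the difference of the levels before a run of twists and [e] the sum of the two
    jumps: the first [gap] is [t + e], and every twist adds [2 * e]. *)
Definition twist_sum (f : int -> int) (n : nat) (t e : int) : int :=
  \sum_(j < n) f (t + (2 * j%:Z + 1) * e).

Lemma wt_twist_mixed g f n i p (sp : size p = i) (x y : color) r w z1 z2 :
  ~~ (x.2 && y.2) ->
  wt g f (power n (twist i) ++ w) (p ++ [:: x, y & r]) z1 z2 =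
  wt g f w (p ++ [:: x, y & r]) (z1 - n%:Z * span_weight (Classical true) x y) z2.
Proof.
move=> xy; elim: n z1 => [|n IH] z1; first by rewrite mul0r subr0.
rewrite powerS -catA.
rewrite -[twist i ++ _]/[:: (Cross (Classical true), i), (Cross Virtual, i)
  & power n (twist i) ++ w].
rewrite !(wt_cross _ _ sp).
have [e1 e2 e3 e4] : [/\ pass (Classical true) x y (ori g y.1) = x,
    pass (Classical true) y x (- ori g x.1) = y,
    self_weight g f (Classical true) x y = 0 & forall z t, pass Virtual z t =1 fun=> z].
  split; try by move: xy; clear; case: x y => [o [hx|]] [o' [hy|]].
  by case=> o [h|].
rewrite e1 e2 e3 !e4 /= !subr0 IH; congr (wt _ _ _ _ _ _).
by rewrite -/(span_weight (Classical true) x y) intS mulrDl mul1r opprD addrA.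
Qed.

Lemma wt_twist g f n i p (sp : size p = i) o a o' b r w z1 z2 :
  wt g f (power n (twist i) ++ w) (p ++ [:: (o, Some a), (o', Some b) & r]) z1 z2 =
  wt g f w
    (p ++ [:: (o, Some (a + n%:Z * ori g o')), (o', Some (b - n%:Z * ori g o)) & r])
    z1 (z2 - sgn o o' * twist_sum f n ((a - b) * 2) (ori g o + ori g o')).
Proof.
elim: n a b z2 => [|n IH] a b z2.
  by rewrite /twist_sum big_ord0 mulr0 !mul0r addr0 !subr0.
rewrite powerS -catA.
rewrite -[twist i ++ _]/[:: (Cross (Classical true), i), (Cross Virtual, i)
  & power n (twist i) ++ w].
rewrite !(wt_cross _ _ sp) /pass /= /span_weight /= !subr0 IH.
rewrite /twist_sum big_ord_recl /self_weight /gap /=.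
congr (wt _ _ _ (_ ++ _) _ _).
  by congr [:: (_, Some _), (_, Some _) & _]; lia.
rewrite [in RHS](mulrDr (sgn o o')) (opprD (sgn o o' * _)) addrA.
congr (_ - _ - _); congr (_ * _); first by congr f; lia.
by apply: eq_bigr => j _; congr f; rewrite /bump /=; lia.
Qed.

(** Reading the sum backwards lets untwists, along which the [gap] moves by [- 2 * e], be expressed
    by the same sums as twists. *)
Lemma twist_sum_rev f n t e :
  twist_sum f n (t + 2 * n%:Z * e) (- e) = twist_sum f n t e.
Proof.
rewrite /twist_sum (reindex_inj rev_ord_inj); apply: eq_bigr => j _ /=; congr f.
rewrite -subzn // intS; ring.
Qed.

Lemma wt_untwist g f n i p (sp : size p = i) o a o' b r w z1 z2 :
  wt g f (power n (untwist i) ++ w) (p ++ [:: (o, Some a), (o', Some b) & r]) z1 z2 =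
  wt g f w
    (p ++ [:: (o, Some (a - n%:Z * ori g o')), (o', Some (b + n%:Z * ori g o)) & r])
    z1
      (z2 + sgn o o' * twist_sum f n
        ((a - b) * 2 - 2 * n%:Z * (ori g o + ori g o')) (ori g o + ori g o')).
Proof.
rewrite -twist_sum_rev subrK.
elim: n a b z2 => [|n IH] a b z2.
  by rewrite /twist_sum big_ord0 mulr0 !mul0r subr0 !addr0.
rewrite powerS -catA.
rewrite -[untwist i ++ _]/[:: (Cross Virtual, i), (Cross (Classical false), i)
  & power n (untwist i) ++ w].
rewrite !(wt_cross _ _ sp) /pass /= /span_weight /= !subr0 IH.
rewrite /twist_sum big_ord_recl /self_weight /gap /=.
congr (wt _ _ _ (_ ++ _) _ _).
  by congr [:: (_, Some _), (_, Some _) & _]; lia.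
rewrite sgnC !mulrN opprK [in RHS](mulrDr (sgn o o')) (addrA z2).
congr (_ + _ + _); congr (_ * _); first by congr f; lia.
by apply: eq_bigr => j _; congr f; rewrite /bump /=; lia.
Qed.

(** The second crossing of a clasp meets the strands in exchanged places: its [gap] is opposite to
    the first, and the levels return. *)
Lemma wt_clasp g f n i p (sp : size p = i) o a o' b r w z1 z2 :
  wt g f (power n (clasp i) ++ w) (p ++ [:: (o, Some a), (o', Some b) & r]) z1 z2 =
  wt g f w (p ++ [:: (o, Some a), (o', Some b) & r])
    z1 (z2 - n%:Z * sgn o o' * (f ((a - b) * 2 + ori g o + ori g o') +
                                f (- ((a - b) * 2 + ori g o + ori g o')))).
Proof.
elim: n z2 => [|n IH] z2; first by rewrite !mul0r !subr0.
rewrite powerS -catA.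
rewrite -[clasp i ++ _]/[:: (Cross (Classical true), i), (Cross (Classical true), i)
  & power n (clasp i) ++ w].
rewrite !(wt_cross _ _ sp) /pass /= /span_weight /= !subr0 addrK subrK IH.
rewrite /self_weight /gap /=; congr (wt _ _ _ _ _ _).
rewrite (sgnC o' o) intS.
rewrite (_ : (b - _ - _) * 2 + _ + _ = - ((a - b) * 2 + ori g o + ori g o')); last by lia.
by ring.
Qed.

Lemma wt_power_mixed g f c c' n i p (sp : size p = i) (x y : color) r w z1 z2 :
  wt g f (power n [:: (Cross c, i); (Cross c', i)] ++ w) (p ++ [:: x, y & r]) z1 z2 ->
  ~~ (x.2 && y.2) -> exists z1', wt g f w (p ++ [:: x, y & r]) z1' z2.
Proof.
move=> + xy; elim: n z1 => [|n IH] z1; first by exists z1.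
rewrite powerS -catA -[_ ++ power n _ ++ w]/[:: (Cross c, i), (Cross c', i)
  & power n [:: (Cross c, i); (Cross c', i)] ++ w].
rewrite !(wt_cross _ _ sp).
have e (u v : color) d t : ~~ (u.2 && v.2) -> pass d u v t = u.
  by case: u v d => [o [h|]] [o' [h'|]] [].
have e' (u v : color) d : ~~ (u.2 && v.2) -> self_weight g f d u v = 0.
  by case: u v d => [o [h|]] [o' [h'|]] [].
by rewrite !e ?e' // 1?andbC // !subr0 => /IH.
Qed.

(** * Weights of the two families *)

Lemma clasp_word_weights f m p k z1 z2 : wt 1 f (clasp_word m p k) [::] z1 z2 ->
  z2 = 0 \/ z2 = m%:Z * (f (4 * p%:Z + 2) + f (- (4 * p%:Z + 2))).
Proof.
rewrite /clasp_word -!catA.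
rewrite (@wt_cup _ _ 0 [::] erefl [::]) => -[x].
rewrite (@wt_cup _ _ 1 [:: x] erefl [:: _]) => -[y].
have [|xy] := boolP (x.2 && y.2); last first.
  move=> /(@wt_power_mixed _ _ _ _ _ _ [::] erefl) /(_ xy) [{}z1].
  move=> /(@wt_power_mixed _ _ _ _ _ _ [::] erefl) /(_ xy) [{}z1].
  move=> /(@wt_power_mixed _ _ _ _ _ _ [::] erefl) /(_ xy) [{}z1].
  rewrite (@wt_cross _ _ 0 [::] erefl) (@wt_cap _ _ 1 [:: _] erefl) => -[_].
  rewrite (@wt_cap _ _ 0 [::] erefl _ _ [::]) => -[_ /wt_trivial[_]].
  by rewrite /self_weight /= => ?; left; lia.
case: x y => [o [a|]] [o' [b|]] //= _.
rewrite (@wt_twist _ _ _ _ [::] erefl) (@wt_clasp _ _ _ _ [::] erefl).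
rewrite (@wt_untwist _ _ _ _ [::] erefl).
rewrite (@wt_cross _ _ 0 [::] erefl) (@wt_cap _ _ 1 [:: _] erefl) => -[[eo ea]].
rewrite (@wt_cap _ _ 0 [::] erefl _ _ [::]) => -[_ /wt_trivial[_]].
(* The closure forces both braid strands to start with the same orientation and level. *)
have {}eo : o' = o by apply: negb_inj.
have {}ea : b = a by lia.
rewrite eo ea (_ : _ - 2 * p%:Z * _ = (a - a) * 2); last by ring.
rewrite /self_weight /= /sgn eqxx subr0 => e; right; move: e.
(* The [p] twists move equal levels apart by [2 * p]; doubling, and adding the two jumps, gives
   [4 * p + 2] up to orientation. *)
rewrite (_ : (a + _ - _) * 2 + _ + _ = if o then 4 * p%:Z + 2 else - (4 * p%:Z + 2)).
  by case: (o); rewrite ?opprK; lia.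
by case: (o); rewrite /ori; lia.
Qed.

Lemma wt_trivial0 g f k : wt g f (trivial_diagram k) [::] 0 0.
Proof.
elim: k => [//|k IH]; rewrite /trivial_diagram [flatten _]/=.
rewrite (@wt_cup _ _ 0 [::] erefl [::]); exists (true, None).
by rewrite (@wt_cap _ _ 0 [::] erefl _ _ [::]).
Qed.

Lemma clasp_word_weight f m p k :
  wt 1 f (clasp_word m p k) [::] 0 (m%:Z * (f (4 * p%:Z + 2) + f (- (4 * p%:Z + 2)))).
Proof.
rewrite /clasp_word -!catA (@wt_cup _ _ 0 [::] erefl [::]); exists (true, Some 0).
rewrite (@wt_cup _ _ 1 [:: _] erefl [:: _]); exists (true, Some 0).
rewrite (@wt_twist _ _ _ _ [::] erefl) (@wt_clasp _ _ _ _ [::] erefl).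
rewrite (@wt_untwist _ _ _ _ [::] erefl).
rewrite (@wt_cross _ _ 0 [::] erefl) (@wt_cap _ _ 1 [:: _] erefl).
rewrite (@wt_cap _ _ 0 [::] erefl _ _ [::]).
rewrite /pass /span_weight /self_weight /bar /= /ori /sgn /= !subr0.
split; first by congr (_, Some _); lia.
split; first by congr (_, Some _); lia.
rewrite (_ : _ - 2 * p%:Z * _ = (0 - 0) * 2); last by ring.
rewrite (_ : (0 + _ - _) * 2 + _ + _ = 4 * p%:Z + 2); last by ring.
by rewrite [X in wt _ _ _ _ _ X](_ : _ = 0); [exact: wt_trivial0 | ring].
Qed.

Lemma twist_sum0 f n t e (b : nat) : (forall u, `|u| <= b%:Z -> f u = 0) ->
  (forall j : nat, (j < n)%N -> `|t + (2 * j%:Z + 1) * e| <= b%:Z) ->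
  twist_sum f n t e = 0.
Proof.
by move=> f0 h; rewrite /twist_sum big1 // => j _; apply/f0/h.
Qed.

(* Levels of the three strands add up to the same total at both ends, so that
   the first strand must come back with the level it had before the twists
   with the span circle. *)
Lemma three_strands_weight f p k c d ox (hx hx' : option int) (y z : color) z1 z2 :
  (forall u, `|u| <= (4 * p)%N%:Z -> f u = 0) -> (0 < p)%N ->
  hx = hx' :> bool ->
  wt 1 f (power p (twist 2) ++ twist 3 ++ power p (untwist 2) ++
    [:: virtual_crossing 2; virtual_crossing 3; (Cap, 4); (Cap, 3); (Cap, 2); (Cap, 0)]%N ++
    trivial_diagram k) [:: c; d; (ox, hx'); y; z; bar z; bar y; bar (ox, hx)] z1 z2 ->
  hx = hx' /\ z2 = 0.
Proof.
move=> f0 p_gt0; case: hx hx' y z => [hx|] [hx'|] [oy [hy|]] [oz [hz|]] // _.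
- rewrite (@wt_twist _ _ _ _ [:: _; _] erefl) (@wt_twist _ _ 1 3 [:: _; _; _] erefl).
  rewrite (@wt_untwist _ _ _ _ [:: _; _] erefl).
  rewrite (@wt_cross _ _ 2 [:: _; _] erefl) (@wt_cross _ _ 3 [:: _; _; _] erefl).
  rewrite (@wt_cap _ _ 4 [:: _; _; _; _] erefl) => -[[e1 e1']].
  rewrite (@wt_cap _ _ 3 [:: _; _; _] erefl) => -[[e2 e2']].
  rewrite (@wt_cap _ _ 2 [:: _; _] erefl _ _ [::]) => -[[e3 e3']].
  rewrite (@wt_cap _ _ 0 [::] erefl _ _ [::]) => -[_ /wt_trivial[_]].
  have {e1}eo : oz = ox by apply: negb_inj.
  have {e2 e3}eo' : oy = ox by apply: negb_inj.
  rewrite {}eo {}eo' in e1' e2' e3' *.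
  (* By the equations at the maxima the doubled indices are, up to a common sign, 4, 8, ..., 4p in
     the twists, -2p at [twist 3] and 2, 6, ..., 4p - 2 in the untwists: all in the range where [f]
     vanishes. *)
  rewrite /self_weight /= !(@twist_sum0 _ _ _ _ _ f0).
    by move=> e; split; [congr Some; lia|lia].
  + by move=> j; case: ox e1' e2' e3' => /=; rewrite /ori; lia.
  + by move=> j; case: ox e1' e2' e3' => /=; rewrite /ori; lia.
  by move=> j; case: ox e1' e2' e3' => /=; rewrite /ori; lia.
(* The three strands close up to one circle, so of the remaining cases the maxima admit only the one
   where all are plain. *)
all: do 3![first [ rewrite (@wt_twist _ _ _ _ [:: _; _] erefl)
  | rewrite (@wt_twist _ _ 1 3 [:: _; _; _] erefl)
  | rewrite (@wt_untwist _ _ _ _ [:: _; _] erefl)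
  | move=> /(@wt_power_mixed _ _ _ _ 1 3 [:: _; _; _] erefl) /(_ isT) [{}z1]
  | move=> /(@wt_power_mixed _ _ _ _ _ 2 [:: _; _] erefl) /(_ isT) [{}z1]]].
all: rewrite (@wt_cross _ _ 2 [:: _; _] erefl) (@wt_cross _ _ 3 [:: _; _; _] erefl).
all: rewrite (@wt_cap _ _ 4 [:: _; _; _; _] erefl) => -[e4].
all: rewrite (@wt_cap _ _ 3 [:: _; _; _] erefl) => -[e3].
all: rewrite (@wt_cap _ _ 2 [:: _; _] erefl _ _ [::]) => -[e2].
all: rewrite (@wt_cap _ _ 0 [::] erefl _ _ [::]) => -[_ /wt_trivial[_ e]].
all: case: e4 => // *; case: e3 => // *; case: e2 => // *.
by split=> //; rewrite /self_weight /= in e; lia.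
Qed.

Lemma span_word_weights f n p k z1 z2 :
  (forall u, `|u| <= (4 * p)%N%:Z -> f u = 0) -> (0 < p)%N ->
  wt 1 f (span_word n p k) [::] z1 z2 -> z2 = 0.
Proof.
move=> f0 p_gt0; rewrite /span_word -!catA.
rewrite (@wt_cup _ _ 0 [::] erefl [::]) => -[c].
rewrite (@wt_cup _ _ 2 [:: _; _] erefl [::]) => -[x].
rewrite (@wt_cup _ _ 3 [:: _; _; _] erefl) => -[y].
rewrite (@wt_cup _ _ 4 [:: _; _; _; _] erefl) => -[z].
have [|cx] := boolP ((bar c).2 && x.2); last first.
  move=> /(@wt_power_mixed _ _ _ _ _ 1 [:: _] erefl) /(_ cx) [{}z1] h.
  case: x cx h => ox hx cx h.
  by have [] := @three_strands_weight f p k c (bar c) ox hx hx y z z1 z2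
    f0 p_gt0 erefl h.
case: c x => [oc [a|]] [ox [b|]] //= _; rewrite (@wt_twist _ _ _ 1 [:: _] erefl).
move=> h.
have [[e]] := @three_strands_weight f p k _ _ _ (Some b) (Some _) _ _ _ _
  f0 p_gt0 (erefl true) h.
(* The twists with the span circle shift the level of the first braid strand by [n] up to sign, yet
   it has to return. *)
have -> : n = 0%N by case: (oc) e => /=; rewrite /ori; lia.
by rewrite /twist_sum big_ord0; lia.
Qed.

Lemma span_word_weight f n p k : (0 < p)%N ->
  (forall u, `|u| < (4 * p)%N%:Z -> f u = 0) -> f (4 * p)%N%:Z = 1 ->
  wt 1 f (span_word n p k) [::] (- n%:Z) 1.
Proof.
move=> p_gt0 f0 f1; rewrite /span_word -!catA.
(* The plain circle runs upwards along strand 1, so each twist with it has span weight -1; the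
   levels 0, -1, 0 of the braid strands are what the maxima require. *)
rewrite (@wt_cup _ _ 0 [::] erefl [::]); exists (false, None).
rewrite (@wt_cup _ _ 2 [:: _; _] erefl [::]); exists (true, Some 0).
rewrite (@wt_cup _ _ 3 [:: _; _; _] erefl); exists (true, Some (-1)).
rewrite (@wt_cup _ _ 4 [:: _; _; _; _] erefl); exists (true, Some 0).
rewrite (@wt_twist_mixed _ _ _ 1 [:: _] erefl) //.
rewrite (@wt_twist _ _ _ _ [:: _; _] erefl) (@wt_twist _ _ 1 3 [:: _; _; _] erefl).
rewrite (@wt_untwist _ _ _ _ [:: _; _] erefl).
rewrite (@wt_cross _ _ 2 [:: _; _] erefl) (@wt_cross _ _ 3 [:: _; _; _] erefl).
rewrite (@wt_cap _ _ 4 [:: _; _; _; _] erefl).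
rewrite (@wt_cap _ _ 3 [:: _; _; _] erefl).
rewrite (@wt_cap _ _ 2 [:: _; _] erefl _ _ [::]).
rewrite (@wt_cap _ _ 0 [::] erefl _ _ [::]).
rewrite /self_weight /span_weight /pass /bar /sgn /ori /=.
do ! [split; first by congr (_, Some _); lia].
split=> //.
have small u : `|u| <= (4 * p - 1)%N%:Z -> f u = 0 by move=> ?; apply: f0; lia.
rewrite !(@twist_sum0 _ 1 _ _ _ small); last by move=> j; lia.
rewrite !(@twist_sum0 _ p (_ - _) _ _ small); last by move=> j; lia.
(* Only the last of the [p] twists reaches the doubled index [4 * p]. *)
rewrite (_ : twist_sum _ _ _ _ = 1); last first.
  case: p p_gt0 f0 f1 small => // p _ f0 f1 small.
  rewrite /twist_sum big_ord_recr /= big1 ?add0r.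
    by rewrite -[RHS]f1; congr f; lia.
  by move=> j _; apply: small; have := ltn_ord j; lia.
rewrite [X in wt _ _ _ _ X](_ : _ = 0); last by ring.
rewrite [X in wt _ _ _ _ _ X](_ : _ = 0); last by ring.
exact: wt_trivial0.
Qed.

(** * Unknotting indices and distinctness of the links *)

Definition link_of (k : nat) (D : diagram k) : set (diagram k) :=
  [set D' | equivalent (val D) (val D')]%classic.

Lemma unknotting_index_link_of k (D : diagram k) (p : nat *l nat) :
  unknottable D p.1 p.2 ->
  (forall D' : diagram k, equivalent (val D) (val D') ->
     forall n m, unknottable D' n m -> (p <= ((n, m) : nat *l nat))%O) ->
  unknotting_index (link_of D) p.
Proof.
move=> Dp min; split.
  exists D; first exact: rst_refl.
  by split=> // -[n m] Dq; apply: min Dq; apply: rst_refl.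
by move=> [n m] [D' DD' [D'q _]]; apply: min D'q.
Qed.

Lemma link_of_eq k (D D' : diagram k) : link_of D = link_of D' ->
  equivalent (val D) (val D').
Proof.
move=> e; have : link_of D' D' by apply: rst_refl.
by rewrite -e.
Qed.

Lemma diagram_of_word k w : is_closed w -> component_count w = k ->
  is_closed w && (component_count w == k).
Proof. by move=> -> ->; rewrite eqxx. Qed.

Theorem proposition3p2 (n m k : nat) (n_gt0 : (0 < n)%N) (m_gt0 : (0 < m)%N)
    (k_gt1 : (1 < k)%N) :
  (exists L : nat -> set (diagram k),
     injective L /\
     forall j, is_virtual_link (L j) /\ unknotting_index (L j) (n, 0%N)) /\
  (exists L : nat -> set (diagram k),
     injective L /\
     forall j, is_virtual_link (L j) /\ unknotting_index (L j) (0%N, m)).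
Proof.
split.
  case: k k_gt1 => [|[|k]] // _; case: n n_gt0 => // n _.
  (* Now [n] is the predecessor of the given number: [n] twists with the span circle and [twist 3]
     offer [n.+1] crossings to virtualize. The [j.+1] keeps the braid twists positive in number. *)
  pose D j : diagram k.+2 := exist _ (span_word n j.+1 k) (diagram_of_word
    (span_word_closed n j.+1 k) (span_word_components n j.+1 k)).
  pose f j (t : int) : int := (t == (4 * j.+1)%N%:Z)%:Z - (t == - (4 * j.+1)%N%:Z)%:Z.
  have fN j t : f j (- t) = - f j t.
    by rewrite /f eqr_opp eqr_oppLR opprB.
  have f0 j : f j 0 = 0 by rewrite /f; lia.
  have fsmall j u : `|u| < (4 * j.+1)%N%:Z -> f j u = 0.
    by rewrite /f; lia.
  have f1 j : f j (4 * j.+1)%N%:Z = 1 by rewrite /f; lia.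
  have Dw j : wt 1 (f j) (val (D j)) [::] (- n%:Z) 1.
    by apply: span_word_weight => //; apply: fsmall.
  (* For [i < j] the doubled indices in [D i] stay below the support of [f j], for which [D j] has
     index sum 1. *)
  have inj i j : (i < j)%N -> link_of (D i) <> link_of (D j).
    move=> ij /link_of_eq e; have := Dw j.
    rewrite -(wt_equivalent 1 (f0 j) _ _ e) => /span_word_weights -/(_ _ isT) h.
    suff : (1 : int) = 0 by [].
    by apply: h => u ?; apply: fsmall; lia.
  exists (fun j => link_of (D j)); split.
    move=> i j e; case: (ltngtP i j) => // ij; first by case: (inj _ _ ij).
    by case: (inj _ _ ij).
  move=> j; split; first by exists (D j).
  apply: unknotting_index_link_of; first exact: span_word_unlink.
  move=> D' DD' n' m' [w aw wt].
  rewrite leEprodlexi /=.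
  (* If the levels survive, the index sum 1 contradicts triviality; otherwise the span goes from
     [- n] to 0 by less than [n'], so [n < n']. *)
  have := Dw j; rewrite (wt_equivalent 1 (f0 j) _ _ DD').
  case/(wt_alter (fN j) aw) => [[z1' h _]|[z1' h lt]]; move: h.
    by rewrite (wt_equivalent 1 (f0 j) _ _ wt) => /wt_trivial[].
  rewrite (@wt_equivalent 0 (fun=> 0) erefl _ _ _ _ wt) => /wt_trivial[e _].
  by move: lt; rewrite e; lia.
case: k k_gt1 => // k _.
pose D j : diagram k.+1 := exist _ (clasp_word m j k) (diagram_of_word
  (clasp_word_closed m j k) (clasp_word_components m j k)).
(* One-sided on purpose: an odd function would cancel on the two opposite indices of a clasp. *)
pose f (j : nat) (t : int) : int := (t == 4 * j%:Z + 2)%:Z.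
have f0 j : f j 0 = 0 by rewrite /f; lia.
have fN j t : `|f j t + f j (- t)| <= 1 by rewrite /f; lia.
have Dw j : wt 1 (f j) (val (D j)) [::] 0 m%:Z.
  have := clasp_word_weight (f j) m j k.
  by rewrite (_ : f j _ + f j _ = 1) ?mulr1 // /f; lia.
have inj : injective (fun j => link_of (D j)).
  move=> i j /link_of_eq e; have := Dw j.
  rewrite -(wt_equivalent 1 (f0 j) _ _ e) => /clasp_word_weights.
  have [// | ij] := eqVneq i j.
  by rewrite (_ : f j _ + f j _ = 0) ?mulr0 /f; lia.
exists (fun j => link_of (D j)); split=> // j; split; first by exists (D j).
apply: unknotting_index_link_of; first exact: clasp_word_unlink.
move=> D' DD' n' m' [w aw wt]; rewrite leEprodlexi /=.
(* For positive [n'] the first entry already decides the lexicographic order. *)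
case: n' aw => // aw.
have := Dw j; rewrite (wt_equivalent 1 (f0 j) _ _ DD').
case/(wt_change (fN j) aw) => z2'; rewrite (wt_equivalent 1 (f0 j) _ _ wt).
by case/wt_trivial=> _ ->; lia.
Qed.
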